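(* Let $G$ be a connected finite simple graph of minimum degree at least $2$ and order at least $9$, and let $f(G)$ be the number of detours of $G$. If $f(G)$ is an odd number, then $f(G)\ge 9$. Furthermore, the lower bound $9$ can be attained for every order by both graphs of connectivity $1$ and graphs of connectivity $2$: for every integer $n\ge 9$ there exist a graph $H$ of order $n$, minimum degree at least $2$ and connectivity exactly $1$ with $f(H)=9$, and a graph $M$ of order $n$, minimum degree at least $2$ and connectivity exactly $2$ with $f(M)=9$.
   Context: All graphs are finite and simple. The order of a graph is its number of vertices. A detour of a graph $G$ is a longest path in $G$, i.e. a path of $G$ with the maximum possible number of vertices among all paths in $G$. Paths are regarded as subgraphs (so a path and its reversal are the same path), and $f(G)$ denotes the number of distinct detours in $G$. Connectivity means vertex connectivity: the minimum number of vertices whose removal leaves a disconnected graph or a graph with a single vertex. *)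

(* Defs.v *)
From mathcomp Require Import all_boot.

Set Implicit Arguments.
Unset Strict Implicit.
Unset Printing Implicit Defensive.

(* Finite simple graphs; the order of [G] is [#|G|]. *)
Record sgraph := SGraph {
  vertex :> finType;
  adj : rel vertex;
  adj_sym : symmetric adj;
  adj_irrefl : irreflexive adj }.

Section Graph.
Variable G : sgraph.

Definition degree (x : G) : nat := #|[set y | adj x y]|.

(* Every degree is less than [#|G|], so the default value of this minimum
   matters only for the graph without vertices. *)
Definition min_degree : nat := \big[minn/#|G|]_(x : G) degree x.

Definition connected : bool := [forall x : G, forall y : G, connect (@adj G) x y].

(* A subgraph is given by its vertex set and its edge set, an edge being an
   unordered pair of vertices. *)
Definition subgraph : predArgType := ({set G} * {set {set G}})%type.

(* The subgraph traced by a sequence of vertices: a sequence and its reversal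
   trace the same subgraph. *)
Definition trace (s : seq G) : subgraph :=
  ([set x in s], [set [set uv.1; uv.2] | uv in zip s (behead s)]).

(* A path has at least one and at most [#|G|] vertices. *)
Definition paths : {set subgraph} :=
  [set P : subgraph | [exists k : 'I_#|G|, exists s : k.+1.-tuple G,
     [&& uniq s, sorted (@adj G) s & P == trace s]]].

Definition detours : {set subgraph} :=
  [set P in paths | [forall Q in paths, #|Q.1| <= #|P.1|]].

Definition num_detours : nat := #|detours|.

Definition del_adj (S : {set G}) : rel {x : G | x \notin S} :=
  fun x y => adj (val x) (val y).

Lemma del_adj_sym S : symmetric (@del_adj S).
Proof. by move=> x y; apply: adj_sym. Qed.

Lemma del_adj_irrefl S : irreflexive (@del_adj S).
Proof. by move=> x; apply: adj_irrefl. Qed.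

Definition del_vertices (S : {set G}) : sgraph :=
  SGraph (@del_adj_sym S) (@del_adj_irrefl S).

End Graph.

(* Removing all vertices but one leaves a graph with a single vertex, so the
   default value of this minimum matters only for the graph without vertices. *)
Definition connectivity (G : sgraph) : nat :=
  \big[minn/#|G|]_(S : {set G} |
      ~~ connected (del_vertices S) || (#|del_vertices S| == 1)) #|S|.

(* Main.v *)
(* A neighbour x of an end a of a detour lies on the detour, and rotating, i.e.
   exchanging the edge entering x for ax, gives a detour again. If the ends of some
   detour are adjacent, G is Hamiltonian and has at least |G| detours. Otherwise
   rotating at both ends a, b in all possible ways gives deg(a) deg(b) >= 4 distinct
   detours. Hence every nonempty set of detours closed under rotations has at least
   four elements, and if f(G) <= 7 is odd it suffices to find a closed set of 4 or 6
   detours: its complement is nonempty and closed, so f(G) >= 8.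
   Let L and R be rotations of a detour at its two ends. Either LR = RL, or the two
   chords cross and then LRL = RLR; in the second case LR and LRL are two additional
   detours. If some end has degree at least 3, then f(G) <= 7 forces end degrees
   3 and 2, commuting rotations, and degree 2 at all rotated ends, so the six
   detours above form a closed set. If all ends have degree 2, the closed set is
   {1, L, R, RL} or {1, L, R, RL, LR, LRL}.
   The examples consist of a fixed graph together with arbitrarily many twins of
   degree two that lie on no detour; the words read along their paths form a finite
   list independent of the number of twins. *)

Require Import Defs.
From mathcomp Require Import all_boot.

Set Implicit Arguments.
Unset Strict Implicit.
Unset Printing Implicit Defensive.

(** * Paths as sequences *)

Section Consecutive.
Variable T : eqType.
Implicit Types (s t A B Z : seq T) (u v x y z : T).

Fixpoint consec s u v : bool :=
  if s is x :: s' then ((u == x) && (ohead s' == Some v)) || consec s' u v else false.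

Definition edge s u v := consec s u v || consec s v u.

Lemma edgeC s u v : edge s u v = edge s v u.
Proof. by rewrite /edge orbC. Qed.

Lemma consec_cat A B u v :
  consec (A ++ B) u v = [|| consec A u v, consec B u v
    | (ohead (rev A) == Some u) && (ohead B == Some v)].
Proof.
elim: A => [|x A IH] /=; first by rewrite orbF.
rewrite IH rev_cons; case: A {IH} => [|y A] /=.
  rewrite (inj_eq Some_inj) [x == u]eq_sym andbF /=.
  by case: (consec B u v); rewrite ?orbT ?orbF.
have -> : ohead (rcons (rev (y :: A)) x) = ohead (rev (y :: A)).
  by rewrite rev_cons; case: (rev A).
by rewrite !orbA.
Qed.

Lemma consec_rev s u v : consec (rev s) u v = consec s v u.
Proof.
elim: s => [|x s IH] //=; rewrite rev_cons -cats1 consec_cat IH revK /=.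
rewrite andbF /= (inj_eq Some_inj) [x == v]eq_sym.
by rewrite orbC andbC.
Qed.

Lemma edge_rev s u v : edge (rev s) u v = edge s u v.
Proof. by rewrite /edge !consec_rev orbC. Qed.

Lemma consec_mem s u v : consec s u v -> (u \in s) && (v \in s).
Proof.
elim: s => [|x s IH] //= /orP[/andP[/eqP-> ]|/IH /andP[us vs]].
  by case: s {IH} => //= y s /eqP[->]; rewrite !inE !eqxx /= orbT.
by rewrite !inE us vs !orbT.
Qed.

Lemma edge_mem s u v : edge s u v -> (u \in s) && (v \in s).
Proof. by case/orP=> /consec_mem /andP[-> ->]. Qed.

Lemma edge_cons2 x y s u v :
  edge (x :: y :: s) u v =
  [|| (u == x) && (v == y), (u == y) && (v == x) | edge (y :: s) u v].
Proof.
rewrite /edge /= !(inj_eq Some_inj) [y == v]eq_sym [y == u]eq_sym.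
case: (u == x); case: (v == y); case: (u == y); case: (v == x) => //=;
by rewrite ?orbT //; do 2!case: (consec s _ _); rewrite ?orbT ?orbF.
Qed.

Lemma edge_head x s z : uniq (x :: s) -> edge (x :: s) x z = (ohead s == Some z).
Proof.
case: s => [|y s] /=; first by rewrite /edge /= !andbF.
move=> /andP[xs _]; rewrite edge_cons2 eqxx /= (inj_eq Some_inj) [y == z]eq_sym.
have [xy|_] := eqVneq x y; first by rewrite xy inE eqxx in xs.
case: (z == y) => //=; apply/negP => /edge_mem/andP[xs' _].
by rewrite xs' in xs.
Qed.

Lemma eq_set2 (F : finType) (a b c d : F) :
  ([set a; b] == [set c; d]) = ((a == c) && (b == d)) || ((a == d) && (b == c)).
Proof.
apply/eqP/orP=> [E|[]/andP[/eqP-> /eqP->]//]; last by rewrite setUC.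
have := set21 a b; have := set22 a b; have := set21 c d; have := set22 c d.
rewrite E -{1 2}E !inE.
by do 4![case/orP=> /eqP ?]; subst; rewrite !eqxx; auto.
Qed.

(* Rotation of a path: when [x] is a neighbour of the first vertex [a] of [s],
   the edge entering [x] is replaced by the edge [ax]; for the second vertex [x]
   of [s] this changes nothing. *)
Definition flipl x s := rev (take (index x s) s) ++ drop (index x s) s.
Definition flipr x s := rev (flipl x (rev s)).

Lemma flipl_cat x A Z : x \notin A -> flipl x (A ++ x :: Z) = rev A ++ x :: Z.
Proof.
move=> xA; rewrite /flipl index_cat (negbTE xA) /= eqxx addn0.
by rewrite take_size_cat // drop_size_cat.
Qed.

Lemma flipr_cat x A Z : x \notin Z -> flipr x (A ++ x :: Z) = A ++ x :: rev Z.
Proof.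
move=> xZ; rewrite /flipr rev_cat rev_cons cat_rcons flipl_cat ?mem_rev //.
by rewrite revK rev_cat rev_cons revK cat_rcons.
Qed.

Lemma flipr_rev x s : flipr x (rev s) = rev (flipl x s).
Proof. by rewrite /flipr revK. Qed.

Lemma flipl_rev x s : flipl x (rev s) = rev (flipr x s).
Proof. by rewrite /flipr revK. Qed.

Lemma uniq_mid x A Z : uniq (A ++ x :: Z) -> (x \notin A) && (x \notin Z).
Proof.
rewrite cat_uniq /= negb_or => /and3P[_ /andP[-> _] /andP[-> _]] //.
Qed.

Lemma fliplK x s : uniq s -> x \in s -> flipl x (flipl x s) = s.
Proof.
move=> us xs; case/splitPr: xs us => A Z /uniq_mid/andP[xA _].
by rewrite !flipl_cat ?mem_rev // revK.
Qed.

Lemma fliprK x s : uniq s -> x \in s -> flipr x (flipr x s) = s.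
Proof. by move=> us xs; rewrite /flipr revK fliplK ?rev_uniq ?mem_rev ?revK. Qed.

Lemma perm_flipl x s : perm_eq (flipl x s) s.
Proof.
by rewrite -{2}(cat_take_drop (index x s) s) perm_cat2r perm_rev.
Qed.

Lemma perm_flipr x s : perm_eq (flipr x s) s.
Proof. by rewrite perm_rev (perm_trans (perm_flipl _ _)) // perm_rev. Qed.

(** The only edge destroyed is the one entering [z], excluded by [z != v]. Edges of the reversed
    prefix survive with the opposite direction, hence [edge] in the conclusion. *)
Lemma flipl_keep s z u v : consec s u v -> z != v -> edge (flipl z s) u v.
Proof.
rewrite /flipl -{1}(cat_take_drop (index z s) s) consec_cat => uv zv.
rewrite /edge !consec_cat !consec_rev.
case/or3P: uv => [->|->|/andP[_]]; rewrite ?orbT //.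
have [zs|zs] := boolP (z \in s); last by rewrite drop_oversize ?memNindex.
rewrite (drop_nth z) ?index_mem // nth_index //= => /eqP[zv'].
by rewrite zv' eqxx in zv.
Qed.

Lemma flipr_keep s z u v : consec s u v -> z != u -> edge (flipr z s) u v.
Proof. by move=> uv zu; rewrite edge_rev edgeC flipl_keep // consec_rev. Qed.

Lemma flipl_new s x0 x u v : edge (flipl x s) u v -> x \in s ->
  edge s u v \/ (u = head x0 s /\ v = x) \/ (v = head x0 s /\ u = x).
Proof.
move=> uv xs; have x_ix := nth_index x0 xs; move: uv.
have H w1 w2 : consec (flipl x s) w1 w2 -> edge s w1 w2 \/ w1 = head x0 s /\ w2 = x.
  have -> : edge s w1 w2 = edge (take (index x s) s ++ drop (index x s) s) w1 w2.
    by rewrite cat_take_drop.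
  rewrite /flipl /edge !consec_cat consec_rev.
  case/or3P=> [->|->|/andP[]]; rewrite ?orbT; try by left.
  rewrite revK (drop_nth x0) ?index_mem // x_ix /= => + /eqP[->].
  by case: (s) => //= a s'; case: (a == x) => //= /eqP[->]; right.
case/orP=> /H[]; auto.
by rewrite edgeC; auto.
Qed.

Lemma flipl_consec s x0 x : x \in s -> x != head x0 s -> consec (flipl x s) (head x0 s) x.
Proof.
case: s => [|a s] //=; rewrite inE eq_sym => + ax; rewrite /flipl /=.
rewrite (negbTE ax) /= consec_cat revK /= eqxx => xs.
by rewrite (drop_nth a) ?index_mem // nth_index //= eqxx !orbT.
Qed.

Lemma flipl_edge_head s x0 x z : uniq s -> x \in s -> x != head x0 s ->
  edge (flipl x s) (head x0 s) z -> z = nth x0 s 1 \/ z = x.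
Proof.
move=> us xs xa /(@flipl_new _ x0)/(_ xs)[]; last first.
  by case=> [[_ ->]|[_ E]]; [right|rewrite E eqxx in xa].
case: s us xs xa => // a s us xs xa; rewrite edge_head //.
by case: s {us xs xa} => //= b s /eqP[->]; left.
Qed.

Lemma flipl_second s x0 : uniq s -> 1 < size s -> flipl (nth x0 s 1) s = s.
Proof.
case: s => [|a [|b s]] //= /andP[]; rewrite inE negb_or => /andP[ab _] _ _.
by rewrite (@flipl_cat b [:: a]) // inE eq_sym.
Qed.

Lemma last_flipl x0 s x : x \in s -> last x0 (flipl x s) = last x0 s.
Proof.
move=> xs; rewrite -{2}(cat_take_drop (index x s) s) /flipl !last_cat.
by rewrite (drop_nth x) ?index_mem.
Qed.

Lemma head_rev x0 s : head x0 (rev s) = last x0 s.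
Proof. by case/lastP: s => // s x; rewrite rev_rcons last_rcons. Qed.

Lemma last_rev x0 s : last x0 (rev s) = head x0 s.
Proof. by rewrite -head_rev revK. Qed.

Lemma head_flipr x0 s x : x \in s -> head x0 (flipr x s) = head x0 s.
Proof. by move=> xs; rewrite head_rev last_flipl ?mem_rev // last_rev. Qed.

Lemma flipr_second s x0 y : uniq s -> y \in s -> y != head x0 s ->
  nth x0 (flipr y s) 1 = nth x0 s 1.
Proof.
move=> us ys; case/splitPr: ys us => A Z us; case/andP: (uniq_mid us) => yA yZ.
by rewrite flipr_cat //; case: A {us yA} => [|a [|b A]] //=; rewrite eqxx.
Qed.

(** The common first vertex has only its successor as neighbour, so the second vertices agree too.
    The edges of the tail are those avoiding the first vertex, and induction applies. *)
Lemma uniq_path_same_head s t x0 : uniq s -> uniq t -> s =i t ->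
  (forall u v, edge s u v = edge t u v) -> head x0 s = head x0 t -> s = t.
Proof.
elim: s t => [|a s IH] [|b t] us ut st est //=.
- by move=> _; have := st b; rewrite !inE eqxx.
- by move=> _; have := st a; rewrite !inE eqxx.
move=> ab; rewrite -{b}ab in ut st est *; congr cons.
have memE : s =i t.
  move=> z; have := st z; rewrite !inE; have [->|//] := eqVneq z a.
  by rewrite (negbTE (proj1 (andP us))) (negbTE (proj1 (andP ut))).
have hE : ohead s = ohead t.
  have H z : (ohead s == Some z) = (ohead t == Some z).
    by rewrite -(edge_head _ us) -(edge_head _ ut).
  case: (s) (H) => [|x s'] /= {}H.
    by case: (t) H => //= y t' /(_ y); rewrite eqxx.
  by apply/esym/eqP; rewrite -H.
apply: IH => //; try by [case/andP: us|case/andP: ut].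
  have drop1 r : uniq (a :: r) -> forall u v,
     edge r u v = [&& edge (a :: r) u v, u != a & v != a].
    case: r => [|c r] ur u v; first by rewrite /edge /= !andbF.
    rewrite edge_cons2; have := @edge_mem (c :: r) u v; 
      case: (edge _ u v) => [/(_ isT)|_].
      case/andP=> ucr vcr; rewrite !orbT /=; case/andP: ur => aN _.
      by apply/esym/andP; split; [apply: contraNneq aN => <-|apply: contraNneq aN => <-].
    by rewrite orbF; case: (u == a); case: (v == a); rewrite //= ?andbF.
  by move=> u v; rewrite (drop1 _ us) (drop1 _ ut) est.
by case: (s) hE; case: (t) => //= ? ? ? ? [].
Qed.

Lemma edge_interior A B x y z :
  edge (A ++ y :: x :: z :: B) x y && edge (A ++ y :: x :: z :: B) x z.
Proof. by rewrite /edge !consec_cat /= !eqxx /= !orbT. Qed.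

(** The first vertex [a] of [t] has at most one neighbour along [t]. Inside [s] it would have two,
    so it is an end of [s]. *)
Lemma uniq_path_eq s t x0 : uniq s -> uniq t -> s =i t ->
  (forall u v, edge s u v = edge t u v) -> t = s \/ t = rev s.
Proof.
move=> us ut st est; case: t ut st est => [|a t] ut st est.
  by left; case: s st {us est} => // x s /(_ x); rewrite !inE eqxx.
have sa : a \in s by rewrite st inE eqxx.
case/splitPr: sa us st est => A B us st est.
case: A us st est => [|a' A] us st est.
  by left; apply: (@uniq_path_same_head _ _ x0) => // u v; rewrite est.
case: B us st est => [|b B] us st est.
  right; apply: (@uniq_path_same_head _ _ x0) => //.
  - by rewrite rev_uniq.
  - by move=> z; rewrite mem_rev st.
  - by move=> u v; rewrite edge_rev est.
  - by rewrite head_rev last_cat.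
exfalso; rewrite lastI in us st est.
move: (belast a' A) (last a' A) us st est => C c; rewrite cat_rcons => us st est.
have cb : c != b.
  move: us; rewrite cat_uniq /= !inE !negb_or => /and3P[_ _].
  by case/andP=> /andP[_ /andP[]].
have /andP[] := edge_interior C B a c b.
rewrite !est !edge_head // => /eqP-> /eqP[E].
by rewrite E eqxx in cb.
Qed.

End Consecutive.

Lemma consec_zip (T : eqType) (s : seq T) u v :
  consec s u v = ((u, v) \in zip s (behead s)).
Proof.
elim: s => [|x [|y s] IH] //=; first by rewrite andbF.
rewrite inE /= -[zip (y :: s) s]/(zip (y :: s) (behead (y :: s))) -IH /=.
by rewrite xpair_eqE (inj_eq Some_inj) [y == v]eq_sym.
Qed.

Lemma sorted_consec (T : eqType) (e : rel T) (s : seq T) :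
  reflect (forall u v, consec s u v -> e u v) (sorted e s).
Proof.
elim: s => [|x [|y s] IH] /=; [by constructor | by constructor=> u v; rewrite andbF | ].
apply: (iffP andP) => [[xy /IH H] u v /orP[/andP[/eqP-> /eqP[<-]] //|/H //]|H].
split; first by apply: H; rewrite !eqxx.
by apply/IH => u v uv; apply: H; apply/orP; right.
Qed.

(** * Rotations of detours *)

Section Detours.
Variables (G : sgraph) (x0 : G).
Implicit Types (s t : seq G) (u v x y z : G) (C : {set subgraph G}).
Local Notation hd s := (head x0 s).
Local Notation lst s := (last x0 s).
Local Notation second s := (nth x0 s 1).
Local Notation penult s := (nth x0 (rev s) 1).

Lemma trace_edge s u v : ([set u; v] \in (trace s).2) = edge s u v.
Proof.
apply/imsetP/idP => [[[a b] /= ab /eqP]|/orP[] uv].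
- have ab' : consec s a b by rewrite consec_zip.
  rewrite eq_set2 => /orP[]/andP[/eqP-> /eqP->]; last rewrite edgeC;
  by rewrite /edge ab'.
- by exists (u, v) => //; rewrite /= -consec_zip.
- by exists (v, u); rewrite /= -?consec_zip // setUC.
Qed.

Lemma trace_mem s u : (u \in (trace s).1) = (u \in s).
Proof. by rewrite inE. Qed.

Lemma card_trace s : uniq s -> #|(trace s).1| = size s.
Proof. by move=> /card_uniqP <-; rewrite cardsE. Qed.

Lemma trace_rev s : trace (rev s) = trace s.
Proof.
congr pair; first by apply/setP=> u; rewrite !inE mem_rev.
apply/setP=> X; apply/imsetP/imsetP=> -[[u v] /=]; rewrite -consec_zip => uv ->.
  by exists (v, u); rewrite /= -?consec_zip -1?consec_rev // setUC.
by exists (v, u); rewrite /= -?consec_zip ?consec_rev // setUC.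
Qed.

Lemma trace_inj s t : uniq s -> uniq t -> trace s = trace t -> t = s \/ t = rev s.
Proof.
move=> us ut st; apply: (@uniq_path_eq _ s t x0) => // [u|u v].
  by rewrite -!trace_mem st.
by rewrite -!trace_edge st.
Qed.

Definition detour s := [/\ uniq s, sorted (@adj G) s &
  forall t, uniq t -> sorted (@adj G) t -> size t <= size s].

Lemma pathsP P : reflect
  (exists s, [/\ s != [::], uniq s, sorted (@adj G) s & P = trace s])
  (P \in paths G).
Proof.
rewrite inE; apply: (iffP existsP) => [[k /existsP[s /and3P[us ss /eqP->]]]|].
  by exists s; split=> //; rewrite -size_eq0 size_tuple.
case=> -[|x s] [] // _ us ss ->; have := max_card (mem (x :: s)).
rewrite (card_uniqP us) => lts; exists (Ordinal lts).
by apply/existsP; exists (in_tuple (x :: s)); rewrite us ss eqxx.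
Qed.

Lemma detour_neq0 s : detour s -> s != [::].
Proof. by case=> _ _ /(_ [:: x0] isT isT); case: s. Qed.

Lemma detoursP P : reflect (exists2 s, detour s & P = trace s) (P \in detours G).
Proof.
rewrite inE; apply: (iffP andP) => [[/pathsP[s [s0 us ss ->]] /forall_inP H]|[s ds ->]].
  exists s => //; split=> // t ut st; case: t ut st => // x t ut st.
  rewrite -(card_trace us) -(card_trace ut); apply: H; apply/pathsP.
  by exists (x :: t).
case: (ds) => us ss H; split; first by apply/pathsP; exists s; rewrite detour_neq0.
apply/forall_inP=> Q /pathsP[t [_ ut st ->]]; rewrite !card_trace //.
exact: H.
Qed.

Lemma detour_trace s : detour s -> trace s \in detours G.
Proof. by move=> ds; apply/detoursP; exists s. Qed.

Lemma detour_adj s u v : detour s -> edge s u v -> adj u v.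
Proof. by case=> _ /sorted_consec H _ /orP[/H //|/H]; rewrite adj_sym. Qed.

Lemma detour_uniq s : detour s -> uniq s. Proof. by case. Qed.

Lemma detour_sub s t : detour s -> perm_eq t s ->
  (forall u v, edge t u v -> adj u v) -> detour t.
Proof.
case=> us ss H ts E; split; first by rewrite (perm_uniq ts).
  by apply/sorted_consec => u v uv; apply: E; rewrite /edge uv.
by move=> r; rewrite (perm_size ts); apply: H.
Qed.

Lemma detour_rev s : detour s -> detour (rev s).
Proof.
move=> ds; apply: (detour_sub ds); first by rewrite perm_rev.
by move=> u v; rewrite edge_rev; apply: detour_adj.
Qed.

(** Otherwise prepending [z] would give a longer path. *)
Lemma nbr_head s z : detour s -> adj (hd s) z -> z \in s.
Proof.
move=> ds hz; case: (ds) => us ss H; apply: contraT => zs.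
have := H (z :: s); rewrite /= us zs ltnn; apply=> //.
by case: (s) ss hz (detour_neq0 ds) => //= a r ->; rewrite adj_sym => ->.
Qed.

Lemma nbr_last s z : detour s -> adj (lst s) z -> z \in s.
Proof.
by move=> /detour_rev ds; rewrite -head_rev -(mem_rev s); apply: nbr_head.
Qed.

Lemma adj_neq u v : adj u v -> v != u.
Proof. by apply: contraTneq => ->; rewrite adj_irrefl. Qed.

Lemma detour_flipl s x : detour s -> adj (hd s) x -> detour (flipl x s).
Proof.
move=> ds hx; apply: (detour_sub ds); first exact: perm_flipl.
move=> u v /(@flipl_new _ _ x0)/(_ (nbr_head ds hx))[|[[-> ->]|[-> ->]]] //.
  exact: detour_adj.
by rewrite adj_sym.
Qed.

Lemma detour_flipr s x : detour s -> adj (lst s) x -> detour (flipr x s).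
Proof.
move=> ds hx; apply: detour_rev; apply: detour_flipl; first exact: detour_rev.
by rewrite head_rev.
Qed.

(** * Rotations at both ends when no detour closes to a cycle *)

Hypothesis nonham : forall s, detour s -> ~~ adj (hd s) (lst s).
Hypothesis deg2 : forall x, 2 <= degree x.

Lemma exists_nbr_neq u v : exists2 w, adj u w & w != v.
Proof.
have : [set y | adj u y] :\ v != set0.
  rewrite -card_gt0; have := deg2 u; rewrite /degree (cardsD1 v).
  by case: (v \in _) => // /ltnW.
by case/set0Pn => w; rewrite !inE => /andP[wv uw]; exists w.
Qed.

Lemma detour_size s : detour s -> 1 < size s.
Proof.
move=> ds; have [w hw _] := exists_nbr_neq (hd s) x0.
have := nbr_head ds hw; have := adj_neq hw.
by case: (s) => [|a [|b r]] //=; rewrite inE => /negbTE->.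
Qed.

Lemma head_neq_last s : detour s -> hd s != lst s.
Proof.
move=> ds; have := detour_uniq ds; case: (s) (detour_size ds) => [|a [|b r]] //= _.
by case/andP=> aN _; apply: contraNneq aN => ->; apply: mem_last.
Qed.

Lemma adj_second s : detour s -> adj (hd s) (second s).
Proof.
move=> ds; apply: (detour_adj ds); case: (s) (detour_size ds) => [|a [|b r]] //= _.
by rewrite /edge /= !eqxx.
Qed.

Lemma adj_penult s : detour s -> adj (lst s) (penult s).
Proof. by move=> ds; rewrite -head_rev; apply: adj_second; apply: detour_rev. Qed.

Lemma nonham_neq s z : detour s -> adj (hd s) z -> z != lst s.
Proof. by move=> ds; apply: contraTneq => ->; apply: nonham. Qed.

Lemma nonham_neq' s z : detour s -> adj (lst s) z -> z != hd s.
Proof. by move=> ds; apply: contraTneq => ->; rewrite adj_sym; apply: nonham. Qed.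

(* The neighbours of the two ends along [s] itself are admitted as [x] and [y],
   so that [phi s] is defined on all pairs of neighbours and [s] is a value. *)
Definition phi s x y := flipr y (flipl x s).

Section Phi.
Variables (s : seq G) (x y : G).
Hypotheses (ds : detour s) (hx : adj (hd s) x) (ly : adj (lst s) y).

Let xs := nbr_head ds hx.
Let ys := nbr_last ds ly.

Lemma last_flipl_adj : adj (lst (flipl x s)) y.
Proof. by rewrite last_flipl. Qed.

Lemma head_flipr_adj : adj (hd (flipr y s)) x.
Proof. by rewrite head_flipr. Qed.

Lemma detour_phi : detour (phi s x y).
Proof. by apply: detour_flipr last_flipl_adj; apply: detour_flipl. Qed.

Lemma detour_phi' : detour (flipl x (flipr y s)).
Proof. by apply: detour_flipl head_flipr_adj; apply: detour_flipr. Qed.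

(** The right rotation destroys only the edge leaving [y]. Since [y] is not [hd s], the chord
    created by the left rotation survives. *)
Lemma phi_head : edge (phi s x y) (hd s) x.
Proof.
apply: flipr_keep; first by apply: flipl_consec => //; apply: adj_neq.
exact: nonham_neq'.
Qed.

Lemma phi_head_sub z : edge (phi s x y) (hd s) z -> z = second s \/ z = x.
Proof.
rewrite /phi edge_rev => /(@flipl_new _ _ x0).
rewrite mem_rev (perm_mem (perm_flipl x s)) head_rev last_flipl // => /(_ ys).
case=> [|[[E]|[_ E]]]; last 1 first.
- by have := nonham_neq' ds ly; rewrite -E eqxx.
- by rewrite edge_rev; apply: flipl_edge_head; rewrite ?detour_uniq ?adj_neq.
by have := head_neq_last ds; rewrite E eqxx.
Qed.

Lemma phi_last : edge (phi s x y) (lst s) y.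
Proof.
rewrite edge_rev -(last_flipl x0 xs) -head_rev /edge flipl_consec //.
  by rewrite mem_rev (perm_mem (perm_flipl x s)).
by rewrite head_rev last_flipl ?adj_neq.
Qed.

Lemma phi_last_sub z : edge (phi s x y) (lst s) z -> z = penult s \/ z = y.
Proof.
have E : nth x0 (rev (flipl x s)) 1 = penult s.
  rewrite -flipr_rev; apply: flipr_second; rewrite ?rev_uniq ?detour_uniq ?mem_rev //.
  by rewrite head_rev nonham_neq.
rewrite edge_rev -(last_flipl x0 xs) -head_rev -E; apply: flipl_edge_head.
- by rewrite rev_uniq (perm_uniq (perm_flipl x s)) detour_uniq.
- by rewrite mem_rev (perm_mem (perm_flipl x s)).
by rewrite head_rev last_flipl ?adj_neq.
Qed.

End Phi.

(** Reversal exchanges the ends, so rotating right first reduces to [phi] of the reversed detour. *)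
Lemma phi_rev s x y : flipl x (flipr y s) = rev (phi (rev s) y x).
Proof. by rewrite /phi (flipl_rev y s) flipr_rev revK. Qed.

Lemma eq_trace_edge s t u v : trace s = trace t -> edge s u v -> edge t u v.
Proof. by rewrite -!trace_edge => ->. Qed.

(* In [phi s x y] the first vertex of [s] is joined to [x] and at most to one other
   vertex, its successor in [s]; this determines [x], and dually [y]. *)
Lemma phi_inj s x y x' y' : detour s ->
  adj (hd s) x -> adj (lst s) y -> adj (hd s) x' -> adj (lst s) y' ->
  trace (phi s x y) = trace (phi s x' y') -> x = x' /\ y = y'.
Proof.
move=> ds hx ly hx' ly' E; split.
  case: (phi_head_sub ds hx' ly' (eq_trace_edge E (phi_head ds hx ly))) => // xE.
  by case: (phi_head_sub ds hx ly (eq_trace_edge (esym E) (phi_head ds hx' ly'))) => ->.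
case: (phi_last_sub ds hx' ly' (eq_trace_edge E (phi_last ds hx ly))) => // yE.
by case: (phi_last_sub ds hx ly (eq_trace_edge (esym E) (phi_last ds hx' ly'))) => ->.
Qed.

Definition Phi s : {set subgraph G} :=
  [set trace (phi s w.1 w.2) | w in setX [set x | adj (hd s) x] [set y | adj (lst s) y]].

Lemma PhiP s P : reflect
  (exists x y, [/\ adj (hd s) x, adj (lst s) y & P = trace (phi s x y)])
  (P \in Phi s).
Proof.
apply: (iffP imsetP) => [[[x y]]|[x [y [hx ly ->]]]].
  by rewrite !inE /= => /andP[hx ly] ->; exists x, y.
by exists (x, y); rewrite ?inE /= ?hx.
Qed.

Lemma card_Phi s : detour s -> #|Phi s| = degree (hd s) * degree (lst s).
Proof.
move=> ds; rewrite card_in_imset ?cardsX // => -[x y] [x' y'].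
rewrite !inE /= => /andP[hx ly] /andP[hx' ly'] /(phi_inj ds hx ly hx' ly').
by case=> -> ->.
Qed.

Lemma Phi_sub s : detour s -> Phi s \subset detours G.
Proof.
move=> ds; apply/subsetP=> P /PhiP[x [y [hx ly ->]]].
by apply: detour_trace; apply: detour_phi.
Qed.

(** * Commuting and crossing rotations *)

Implicit Types (A B Z : seq G).

Lemma trace_ends s t : uniq s -> uniq t -> trace s = trace t ->
  hd t = hd s /\ lst t = lst s \/ hd t = lst s /\ lst t = hd s.
Proof.
move=> us ut /(trace_inj us ut)[]->; first by left.
by right; rewrite head_rev last_rev.
Qed.

(** With [y] before [x] the chords cross and the rotations satisfy a braid relation: both words of
    length three exchange the outer blocks [A] and [Z]. *)
Lemma cross_flips A B Z x y : uniq (A ++ y :: B ++ x :: Z) ->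
  let s := A ++ y :: B ++ x :: Z in
  [/\ flipr y (flipl x s) = rev B ++ y :: rev Z ++ x :: A,
      flipl x (flipr y s) = Z ++ y :: rev A ++ x :: rev B,
      flipl x (flipr y (flipl x s)) = Z ++ y :: B ++ x :: A &
      flipr y (flipl x (flipr y s)) = Z ++ y :: B ++ x :: A].
Proof.
move=> us s; have us' : uniq ((A ++ y :: B) ++ x :: Z) by rewrite -catA.
have /andP[] := uniq_mid us; rewrite !mem_cat !inE !negb_or.
move=> yA /and3P[yB yx yZ].
have /andP[] := uniq_mid us'; rewrite !mem_cat !inE !negb_or.
move=> /and3P[xA xy xB] xZ.
have E1 : flipl x s = rev B ++ y :: rev A ++ x :: Z.
  rewrite /s -cat_cons catA flipl_cat ?mem_cat ?inE ?negb_or ?xA ?xy //.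
  by rewrite rev_cat rev_cons cat_rcons -catA.
have E2 : flipr y s = A ++ y :: rev Z ++ x :: rev B.
  rewrite /s flipr_cat ?mem_cat ?inE ?negb_or ?yB ?yx //.
  by rewrite rev_cat rev_cons cat_rcons.
have E3 : flipr y (flipl x s) = rev B ++ y :: rev Z ++ x :: A.
  rewrite E1 flipr_cat ?mem_cat ?inE ?mem_rev ?negb_or ?yA ?yx //.
  by rewrite rev_cat rev_cons revK cat_rcons.
have E4 : flipl x (flipr y s) = Z ++ y :: rev A ++ x :: rev B.
  rewrite E2 -cat_cons catA flipl_cat ?mem_cat ?inE ?mem_rev ?negb_or ?xA ?xy //.
  by rewrite rev_cat rev_cons revK cat_rcons -catA.
split=> //.
  rewrite E3 -cat_cons catA flipl_cat ?mem_cat ?inE ?mem_rev ?negb_or ?xB ?xy //.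
  by rewrite rev_cat rev_cons !revK cat_rcons -catA.
rewrite E4 flipr_cat ?mem_cat ?inE ?mem_rev ?negb_or ?yA ?yx //.
by rewrite rev_cat rev_cons !revK cat_rcons.
Qed.

(* In the second case [y] precedes [x], so the chords cross; if [B] were empty, the
   chords would close a cycle through all vertices of [s]. *)
Lemma flips_comm_or_cross s x y : detour s -> adj (hd s) x -> adj (lst s) y ->
  flipl x (flipr y s) = flipr y (flipl x s) \/
  exists A B Z, [/\ A != [::], B != [::], Z != [::] & s = A ++ y :: B ++ x :: Z].
Proof.
move=> ds hx ly; have us := detour_uniq ds; have ys := nbr_last ds ly.
have dRL := detour_phi ds hx ly.
have xs := nbr_head ds hx; case/splitPr: xs us ys ds hx ly dRL => A Z us.
have /andP[xA xZ] := uniq_mid us.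
rewrite mem_cat inE => ys ds hx ly dRL.
have [yx|yx] := eqVneq y x.
  by left; rewrite yx !(flipl_cat, flipr_cat).
(* If [y] comes after [x], the two rotations reverse disjoint pieces of the path and commute. *)
have [yZ|yZ] := boolP (y \in Z).
  left; case/splitPr: yZ us xZ {ys ds hx ly dRL} => M {}Z us.
  rewrite mem_cat inE !negb_or => /and3P[xM _ xZ].
  rewrite -cat_cons catA in us; have /andP[yAM yZ] := uniq_mid us.
  move: (yAM); rewrite mem_cat inE !negb_or => /and3P[yA _ yM].
  rewrite -cat_cons catA flipr_cat // -!catA !cat_cons !flipl_cat //.
  by rewrite -[in RHS]cat_cons catA flipr_cat // -catA.
move: ys; rewrite (negbTE yZ) (negbTE yx) !orbF => yA; right.
case/splitPr: yA us xA ds hx ly dRL => {}A B; rewrite -!catA !cat_cons => us _ ds hx ly.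
have [E _ _ _] := cross_flips us; rewrite /phi E => dRL.
have A0 : A != [::].
  by apply: contraTneq (nonham_neq' ds ly) => ->; rewrite negbK.
exists A, B, Z; split=> //.
- apply: contraTneq isT => B0; have := nonham dRL; rewrite B0 /= !last_cat /=.
  case/lastP: A A0 ds {E us dRL hx ly} => // A a _.
  rewrite B0 last_rcons cat_rcons /= => ds; rewrite adj_sym => /negP[].
  by apply: (detour_adj ds); rewrite /edge consec_cat /= !eqxx !orbT.
- apply: contraTneq (nonham_neq ds hx) => ->.
  by rewrite last_cat /= last_cat /= eqxx.
Qed.

Lemma last_cat_cons (y : G) A B : lst (A ++ y :: B) = last y B.
Proof. by rewrite last_cat. Qed.

Lemma head_cat_neq0 A B : A != [::] -> hd (A ++ B) = hd A.
Proof. by case: A. Qed.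

Lemma last_neq0 z A : A != [::] -> last z A = lst A.
Proof. by case: A. Qed.

Lemma head_mem A : A != [::] -> hd A \in A.
Proof. by case: A => //= a A _; rewrite mem_head. Qed.

Lemma last_mem A : A != [::] -> lst A \in A.
Proof. by case: A => //= a A _; apply: mem_last. Qed.

Lemma uniq_cat_neq A B u v : uniq (A ++ B) -> u \in A -> v \in B -> u <> v.
Proof.
rewrite cat_uniq => /and3P[_ /hasPn nAB _] uA vB E.
by have := nAB v vB; rewrite -E uA.
Qed.

Lemma rev_neq0 A : (rev A != [::]) = (A != [::]).
Proof. by rewrite -!size_eq0 size_rev. Qed.

(** The unordered pairs of ends already differ: they lie in the blocks [B] and [A], in [Z] and [B],
    and in [Z] and [A], and the blocks are disjoint. *)
Lemma cross_traces A B Z x y : uniq (A ++ y :: B ++ x :: Z) ->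
  A != [::] -> B != [::] -> Z != [::] ->
  let RL := rev B ++ y :: rev Z ++ x :: A in
  let LR := Z ++ y :: rev A ++ x :: rev B in
  let W := Z ++ y :: B ++ x :: A in
  [/\ trace RL <> trace LR, trace RL <> trace W & trace LR <> trace W].
Proof.
move=> us A0 B0 Z0 RL LR W.
have [E1 E2 E3 _] := cross_flips us.
have uRL : uniq RL.
  by rewrite /RL -E1 (perm_uniq (perm_flipr _ _)) (perm_uniq (perm_flipl _ _)).
have uLR : uniq LR.
  by rewrite /LR -E2 (perm_uniq (perm_flipl _ _)) (perm_uniq (perm_flipr _ _)).
have uW : uniq W by rewrite /W -E3 E1 (perm_uniq (perm_flipl _ _)).
have dAB u v : u \in A -> v \in B -> u <> v.
  by move=> uA vB; apply: (uniq_cat_neq us) => //; rewrite inE mem_cat vB orbT.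
have dAZ u v : u \in A -> v \in Z -> u <> v.
  by move=> uA vZ; apply: (uniq_cat_neq us) => //; rewrite inE mem_cat inE vZ !orbT.
have dBZ u v : u \in B -> v \in Z -> u <> v.
  move: us; rewrite -cat_cons catA => us' uB vZ.
  by apply: (uniq_cat_neq us'); rewrite ?mem_cat ?inE ?uB ?vZ !orbT.
have hRL : hd RL = lst B by rewrite /RL head_cat_neq0 ?rev_neq0 // head_rev.
have lRL : lst RL = lst A by rewrite /RL last_cat_cons last_cat /= last_neq0.
have hLR : hd LR = hd Z by rewrite /LR head_cat_neq0.
have lLR : lst LR = hd B.
  by rewrite /LR last_cat_cons last_cat /= last_neq0 ?rev_neq0 // last_rev.
have hW : hd W = hd Z by rewrite /W head_cat_neq0.
have lW : lst W = lst A by rewrite /W last_cat_cons last_cat /= last_neq0.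
have [hA lA] := (head_mem A0, last_mem A0).
have [hB lB] := (head_mem B0, last_mem B0).
have [hZ lZ] := (head_mem Z0, last_mem Z0).
split.
- move=> /(trace_ends uRL uLR); rewrite hRL hLR lRL lLR => -[][E1' E2'].
    exact: (dBZ _ _ lB hZ (esym E1')).
  exact: (dAZ _ _ lA hZ (esym E1')).
- move=> /(trace_ends uRL uW); rewrite hRL hW lRL lW => -[][E1' E2'].
    exact: (dBZ _ _ lB hZ (esym E1')).
  exact: (dAZ _ _ lA hZ (esym E1')).
move=> /(trace_ends uLR uW); rewrite hLR hW lLR lW => -[][E1' E2'].
  exact: (dAB _ _ lA hB E2').
exact: (dAZ _ _ lA hZ E2').
Qed.

Lemma trace_flipl_rev z t : trace (flipl z (rev t)) = trace (flipr z t).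
Proof. by rewrite flipl_rev trace_rev. Qed.

Lemma second_flipr s y : detour s -> adj (lst s) y -> second (flipr y s) = second s.
Proof.
move=> ds ly; apply: flipr_second; first exact: detour_uniq.
  exact: (nbr_last ds).
exact: nonham_neq'.
Qed.

Lemma penult_flipl s x : detour s -> adj (hd s) x -> penult (flipl x s) = penult s.
Proof.
move=> ds hx; rewrite -flipr_rev second_flipr //; first exact: detour_rev.
by rewrite last_rev.
Qed.

Lemma flipl_id s : detour s -> flipl (second s) s = s.
Proof. by move=> ds; apply: flipl_second; [apply: detour_uniq|apply: detour_size]. Qed.

Lemma flipr_id s : detour s -> flipr (penult s) s = s.
Proof. by move=> ds; rewrite /flipr flipl_id ?revK //; apply: detour_rev. Qed.

Lemma phi_second s y : detour s -> phi s (second s) y = flipr y s.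
Proof. by move=> ds; rewrite /phi flipl_id. Qed.

Lemma flipl_split s x : detour s -> adj (hd s) x ->
  exists A c Z, s = rcons A c ++ x :: Z /\ flipl x s = c :: rev A ++ x :: Z.
Proof.
move=> ds hx; have us := detour_uniq ds; have := adj_neq hx.
have xs := nbr_head ds hx; case/splitPr: xs us {ds hx} => A Z us.
case/lastP: A us => [|A c] us; first by rewrite eqxx.
have /andP[xA _] := uniq_mid us => _; exists A, c, Z.
by rewrite flipl_cat // rev_rcons.
Qed.

Lemma adj_head_flipl s x : detour s -> adj (hd s) x -> adj (hd (flipl x s)) x.
Proof.
move=> ds hx; have [A [c [Z [E ->]]]] := flipl_split ds hx.
apply: (detour_adj ds); rewrite E cat_rcons /edge consec_cat /=.
by rewrite !eqxx !orbT.
Qed.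

Lemma second_flipl_neq s x : detour s -> adj (hd s) x -> x != second s ->
  x != second (flipl x s).
Proof.
move=> ds hx; have [A [c [Z [E ->]]]] := flipl_split ds hx.
have := detour_uniq ds; rewrite {1}E => /uniq_mid/andP[xA _].
rewrite E; case/lastP: A {E} xA => [|A b] xA; first by rewrite /= eqxx.
move=> _; apply: contraNneq xA => ->.
by rewrite rev_rcons /= mem_rcons inE mem_rcons inE eqxx orbT.
Qed.

(** By [phi_head_sub] and [phi_last_sub], an element of the grid contains chords at the old ends
    only about its own pivots, so containing both chords determines the pair. *)
Lemma Phi_unique s x y t : detour s -> adj (hd s) x -> adj (lst s) y ->
  x != second s -> y != penult s -> edge t (hd s) x -> edge t (lst s) y ->
  trace t \in Phi s -> trace t = trace (phi s x y).
Proof.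
move=> ds hx ly xs yp tx ty /PhiP[x' [y' [hx' ly' E]]].
have [xE|->] := phi_head_sub ds hx' ly' (eq_trace_edge E tx).
  by rewrite xE eqxx in xs.
have [yE|->//] := phi_last_sub ds hx' ly' (eq_trace_edge E ty).
by rewrite yE eqxx in yp.
Qed.

Lemma comm_second s y : detour s -> adj (lst s) y ->
  flipl (second s) (flipr y s) = phi s (second s) y.
Proof.
move=> ds ly; rewrite phi_second // -(second_flipr ds ly).
by apply: flipl_id; apply: detour_flipr.
Qed.

Lemma comm_penult s x : detour s -> adj (hd s) x ->
  flipl x (flipr (penult s) s) = phi s x (penult s).
Proof.
move=> ds hx; rewrite flipr_id // /phi -(penult_flipl ds hx) flipr_id //.
exact: detour_flipl.
Qed.

(** Both additional detours contain both chords, so by [Phi_unique] the only element of [Phi s] they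
    could equal is [phi s x y], which [cross_traces] excludes. *)
Lemma cross_card s x y : detour s -> adj (hd s) x -> adj (lst s) y ->
  flipl x (flipr y s) <> phi s x y ->
  [/\ x != second s, y != penult s,
    flipr y (flipl x (flipr y s)) = flipl x (phi s x y) &
    #|trace (flipl x (flipr y s)) |: (trace (flipl x (phi s x y)) |: Phi s)|
      = (#|Phi s|).+2].
Proof.
move=> ds hx ly ncomm.
have xs : x != second s.
  by apply/eqP => xE; apply: ncomm; rewrite xE comm_second.
have yp : y != penult s.
  by apply/eqP => yE; apply: ncomm; rewrite yE comm_penult.
case: (flips_comm_or_cross ds hx ly) => // -[A [B [Z [A0 B0 Z0 E]]]].
have us := detour_uniq ds; rewrite {1}E in us.
have [E1 E2 E3 E4] := cross_flips us.
have [T1 T2 T3] := cross_traces us A0 B0 Z0.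
rewrite -E in E1 E2 E3 E4; have E34 := etrans E4 (esym E3).
split=> //; rewrite !cardsU1.
have dL := detour_flipl ds hx; have dR := detour_flipr ds ly.
have hxR : adj (hd (flipr y s)) x by apply: head_flipr_adj.
have lyL : adj (lst (flipl x s)) y by apply: last_flipl_adj.
have hxL := adj_head_flipl ds hx.
have lyR : adj (lst (flipr y s)) y.
  by rewrite /flipr last_rev; apply: adj_head_flipl; [apply: detour_rev|rewrite head_rev].
have -> : trace (flipl x (phi s x y)) \notin Phi s.
  apply/negP => /(Phi_unique ds hx ly xs yp) H.
  apply: T2; rewrite -E1 -E3; apply/esym/H.
    (* Each form of the triple product exhibits one chord: as a [phi] of [flipr y s] the one at
       [hd s], as a reversed [phi] of [rev (flipl x s)] the one at [lst s]. *)
    rewrite /phi -E34 -(head_flipr x0 (nbr_last ds ly)).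
    exact: phi_head.
  rewrite /phi (phi_rev (flipl x s)) edge_rev.
  have := @phi_head (rev (flipl x s)) y x; rewrite head_rev last_rev last_flipl.
    by apply=> //; apply: detour_rev.
  exact: nbr_head ds hx.
have -> : trace (flipl x (flipr y s)) \notin trace (flipl x (phi s x y)) |: Phi s.
  rewrite in_setU1 negb_or; apply/andP; split.
    by apply/eqP; rewrite /phi E3 E2.
  apply/negP => /(Phi_unique ds hx ly xs yp) H.
  apply: T1; rewrite -E1 -E2; apply/esym/H; rewrite phi_rev edge_rev.
    have := @phi_last (rev s) y x; rewrite head_rev last_rev.
    by apply=> //; apply: detour_rev.
  have := @phi_head (rev s) y x; rewrite head_rev last_rev.
  by apply=> //; apply: detour_rev.
by [].
Qed.

(** * Sets of detours closed under rotations *)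

(** Since [t] ranges over both sequences tracing a detour, left rotations cover the rotations at
    both ends. *)
Definition flip_closed C := forall t z, detour t -> trace t \in C -> adj (hd t) z ->
  trace (flipl z t) \in C.

Lemma closed_flipr C t z : flip_closed C -> detour t -> trace t \in C ->
  adj (lst t) z -> trace (flipr z t) \in C.
Proof.
move=> clC dt tC lz; rewrite trace_rev; apply: clC; rewrite ?trace_rev ?head_rev //.
exact: detour_rev.
Qed.

Lemma Phi_closed_sub C s : flip_closed C -> detour s -> trace s \in C -> Phi s \subset C.
Proof.
move=> clC ds sC; apply/subsetP=> P /PhiP[x [y [hx ly ->]]].
apply: closed_flipr => //; last exact: last_flipl_adj.
  exact: detour_flipl.
exact: clC.
Qed.

(** Rotations are involutions, so one that leads into [C] starts in [C]. *)
Lemma closedC C : flip_closed C -> flip_closed (detours G :\: C).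
Proof.
move=> clC t z dt; rewrite !in_setD => /andP[tC _] hz.
rewrite (detour_trace (detour_flipl dt hz)) andbT; apply: contra tC => /clC H.
have := H z (detour_flipl dt hz) (adj_head_flipl dt hz).
by rewrite fliplK ?(nbr_head dt hz) ?detour_uniq.
Qed.

Lemma closed_card C s : flip_closed C -> detour s -> trace s \in C -> 4 <= #|C|.
Proof.
move=> clC ds sC; apply: leq_trans (subset_leq_card (Phi_closed_sub clC ds sC)).
by rewrite card_Phi // (leq_mul (deg2 _) (deg2 _)).
Qed.

(** Parity makes the complement nonempty; being closed too, it contributes four further detours. *)
Lemma no_closed C : flip_closed C -> C \subset detours G -> 4 <= #|C| -> ~~ odd #|C| ->
  #|detours G| <= 7 -> odd #|detours G| -> False.
Proof.
move=> clC CD C4 Codd D7 Dodd; have := cardsID C (detours G).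
rewrite (setIidPr CD) => E.
case: (set_0Vmem (detours G :\: C)) => [E0|[P PC]].
  by move: Codd; rewrite -E E0 cards0 addn0 in Dodd; rewrite Dodd.
have /detoursP[s ds Ps] : P \in detours G by case/setDP: PC.
rewrite Ps in PC; have := closed_card (closedC clC) ds PC => D4.
by move: D7; rewrite -E leqNgt (leq_add C4 D4).
Qed.

(** * Graphs with at most seven detours *)

Hypothesis D7 : #|detours G| <= 7.

Lemma deg_le7 s : detour s -> degree (hd s) * degree (lst s) <= 7.
Proof.
by move=> ds; rewrite -card_Phi // (leq_trans _ D7) // subset_leq_card // Phi_sub.
Qed.

(** A crossing would add two detours to the at least six in [Phi s]. *)
Lemma flips_comm s x y : detour s -> 6 <= degree (hd s) * degree (lst s) ->
  adj (hd s) x -> adj (lst s) y -> flipl x (flipr y s) = phi s x y.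
Proof.
move=> ds d6 hx ly; apply/eqP/negPn/negP => /eqP /(cross_card ds hx ly)[_ _ _].
move=> E; have : 8 <= #|detours G|; last by rewrite leqNgt ltnS D7.
rewrite -card_Phi // -2!ltnS in d6; rewrite (leq_trans d6) // -E.
apply: subset_leq_card; rewrite !subUset !sub1set Phi_sub // andbT.
rewrite (detour_trace (detour_phi' ds hx ly)) detour_trace //.
apply: detour_flipl; first exact: detour_phi.
rewrite head_flipr; first exact: adj_head_flipl.
by rewrite (perm_mem (perm_flipl _ _)) (nbr_last ds).
Qed.

Lemma degree2P u p q z : degree u = 2 -> adj u p -> adj u q -> p != q ->
  adj u z -> z = p \/ z = q.
Proof.
move=> du up uq pq uz; have : [set p; q] == [set w | adj u w].
  by rewrite eqEcard subUset !sub1set !inE up uq cards2 pq -/(degree u) du.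
by move=> /eqP/setP/(_ z); rewrite !inE uz => /orP[]/eqP; auto.
Qed.

Lemma degree3_nbr u p q : 2 < degree u -> exists w, [/\ adj u w, w != p & w != q].
Proof.
move=> d3; have : [set y | adj u y] :\ p :\ q != set0.
  rewrite -card_gt0; move: d3; rewrite /degree (cardsD1 p) (cardsD1 q (_ :\ p)).
  by do 2!case: (_ \in _); rewrite ?add0n ?add1n ?ltnS // => H; apply: leq_trans H.
by case/set0Pn=> w; rewrite !inE => /and3P[wq wp uw]; exists w.
Qed.

(* Otherwise the rotations about the new end give a second grid of six detours, to
   which the two detours using the third neighbour of [hd s] do not belong. *)
Lemma flipped_head_degree s x : detour s -> 2 < degree (hd s) -> adj (hd s) x ->
  x != second s -> degree (hd (flipl x s)) = 2.
Proof.
move=> ds d3 hx xs; apply/eqP; rewrite eqn_leq deg2 andbT leqNgt; apply/negP => e3.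
have dL := detour_flipl ds hx.
have [x2 [hx2 x2x x2s]] := degree3_nbr x (second s) d3.
have [y ly yp] := exists_nbr_neq (lst s) (penult s).
have lp := adj_penult ds.
have lastL : lst (flipl x s) = lst s by apply/last_flipl/nbr_head.
have notin y' : adj (lst s) y' -> trace (phi s x2 y') \notin Phi (flipl x s).
  move=> ly'; apply/negP => /PhiP[z [y'' []]]; rewrite lastL => hz ly'' E.
  (* Rotating back about [x] leads to [phi s (second s) y'']; any other rotation keeps the chord
     from [hd s] to [x]. Neither is compatible with [phi s x2 y']. *)
  have [zx|zx] := eqVneq z x.
    move: E; rewrite zx /phi fliplK ?detour_uniq ?(nbr_head ds hx) //.
    rewrite -/(phi s x2 y') -phi_second //
      => /(phi_inj ds hx2 ly' (adj_second ds) ly'')[x2E].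
    by rewrite x2E eqxx in x2s.
  have : edge (phi (flipl x s) z y'') (hd s) x.
    rewrite -flips_comm ?lastL // ?(leq_mul e3 (deg2 _)) //.
    rewrite -/(phi s x y'') -flips_comm ?(leq_mul d3 (deg2 _)) //.
    apply: flipl_keep => //; rewrite -(head_flipr x0 (nbr_last ds ly'')).
    have hxR : adj (hd (flipr y'' s)) x by apply: head_flipr_adj.
    by apply: flipl_consec; [apply: nbr_head; first apply: detour_flipr|apply: adj_neq].
  move/(eq_trace_edge (esym E))/(phi_head_sub ds hx2 ly') => -[xE|xE].
    by rewrite xE eqxx in xs.
  by rewrite xE eqxx in x2x.
have : 8 <= #|detours G|; last by rewrite leqNgt ltnS D7.
have C8 : 8 <= #|trace (phi s x2 (penult s)) |: (trace (phi s x2 y) |: Phi (flipl x s))|.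
  rewrite !cardsU1 notin // in_setU1 negb_or notin // andbT card_Phi // lastL.
  have -> : trace (phi s x2 (penult s)) != trace (phi s x2 y).
    apply/eqP => /(phi_inj ds hx2 lp hx2 ly)[_ E].
    by rewrite E eqxx in yp.
  by rewrite !add1n !ltnS (leq_mul e3 (deg2 _)).
apply: leq_trans C8 (subset_leq_card _); rewrite !subUset !sub1set Phi_sub //.
by rewrite !detour_trace //; apply: detour_phi.
Qed.

Definition commuting s := forall x y, adj (hd s) x -> adj (lst s) y ->
  flipl x (flipr y s) = phi s x y.

Lemma commuting_rev s : detour s -> commuting s -> commuting (rev s).
Proof.
move=> ds cs x y; rewrite head_rev last_rev => lx hy.
by rewrite phi_rev revK -cs // /phi flipl_rev flipr_rev.
Qed.

Lemma Phi_rev_sub s : detour s -> commuting s -> Phi (rev s) \subset Phi s.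
Proof.
move=> ds cs; apply/subsetP=> P /PhiP[x [y]]; rewrite head_rev last_rev.
move=> [lx hy ->]; rewrite /phi flipl_rev flipr_rev trace_rev cs //.
by apply/PhiP; exists y, x.
Qed.

(** If [x] is [second s], the head has not moved and commutation puts the result in the grid.
    Otherwise the new head has degree two, so the rotation undoes the one about [x] or is
    trivial. *)
Lemma flipl_Phi s x y z : detour s -> commuting s ->
  (forall x, adj (hd s) x -> x != second s -> degree (hd (flipl x s)) = 2) ->
  adj (hd s) x -> adj (lst s) y -> adj (hd (phi s x y)) z ->
  trace (flipl z (phi s x y)) \in Phi s.
Proof.
move=> ds cs d2 hx ly; have lyL := last_flipl_adj ds hx ly.
have dphi := detour_phi ds hx ly.
have hE : hd (phi s x y) = hd (flipl x s).
  apply: head_flipr; apply: nbr_last => //; exact: detour_flipl.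
rewrite hE => hz.
have [xE|xs] := eqVneq x (second s).
  move: hz; rewrite xE flipl_id // => hz; rewrite phi_second // cs //.
  by apply/PhiP; exists z, y.
have dR := detour_flipr ds ly.
have hxR : adj (hd (flipr y s)) x by apply: head_flipr_adj.
have sx : x != second (phi s x y).
  by rewrite -cs //; apply: second_flipl_neq => //; rewrite second_flipr.
have hsec := adj_second dphi; rewrite hE in hsec.
case: (degree2P (d2 _ hx xs) (adj_head_flipl ds hx) hsec sx hz) => ->.
  rewrite -cs // fliplK ?detour_uniq ?(nbr_head dR) //.
  by rewrite -phi_second //; apply/PhiP; exists (second s), y; rewrite adj_second.
by rewrite flipl_id //; apply/PhiP; exists x, y.
Qed.

Lemma Phi_closed s : detour s -> commuting s ->
  (forall x, adj (hd s) x -> x != second s -> degree (hd (flipl x s)) = 2) ->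
  (forall y, adj (lst s) y -> y != penult s -> degree (lst (flipr y s)) = 2) ->
  flip_closed (Phi s).
Proof.
move=> ds cs dl dr t z dt /PhiP[x [y [hx ly E]]] hz.
have dphi := detour_phi ds hx ly.
have [tE|tE] := trace_inj (detour_uniq dphi) (detour_uniq dt) (esym E).
  by rewrite tE in hz *; apply: flipl_Phi.
(* For the reversed orientation, commutation makes the grid of [rev s] part of that of [s]. *)
apply: (subsetP (Phi_rev_sub ds cs)).
have tE' : t = phi (rev s) y x by rewrite tE -cs // phi_rev revK.
rewrite tE' in hz *; apply: flipl_Phi => //.
- exact: detour_rev.
- exact: commuting_rev.
- move=> w; rewrite head_rev flipl_rev head_rev => lw; exact: dr.
- by rewrite head_rev.
by rewrite last_rev.
Qed.

Hypothesis Dodd : odd #|detours G|.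

(** Degree at least three at one end forces degree two at the other, since a product of nine is too
    large. Then [Phi s] is closed and has an even number of elements. *)
Lemma detour_head_degree s : detour s -> degree (hd s) = 2.
Proof.
move=> ds; apply/eqP; rewrite eqn_leq deg2 andbT leqNgt; apply/negP => d3.
have d7 := deg_le7 ds.
have d6 : 6 <= degree (hd s) * degree (lst s) by rewrite (leq_mul d3 (deg2 _)).
have cs : commuting s by move=> x y; apply: flips_comm.
have degr t : detour t -> hd t = hd s -> degree (lst t) = 2.
  move=> dt tE; have := deg_le7 dt; rewrite tE => t7.
  apply/eqP; rewrite eqn_leq deg2 andbT leqNgt; apply/negP => l3.
  by have := leq_mul d3 l3; rewrite leqNgt ltnS (leq_trans t7).
have cl : flip_closed (Phi s).
  apply: Phi_closed => // [x hx xs|y ly yp]; first exact: flipped_head_degree.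
  by apply: degr; [apply: detour_flipr|apply: head_flipr; apply: nbr_last].
apply: (no_closed cl (Phi_sub ds)); rewrite ?card_Phi //.
  exact: leq_trans d6.
by rewrite oddM (degr s) // andbF.
Qed.

Lemma detour_last_degree s : detour s -> degree (lst s) = 2.
Proof. by move=> ds; rewrite -head_rev; apply: detour_head_degree; apply: detour_rev. Qed.

(** The condition is invariant under the left rotation about [x] and the right one about [y], so a
    whole orbit shares these pivots. *)
Definition proper_chords x y s := [/\ detour s, adj (hd s) x, adj (lst s) y,
  x != second s & y != penult s].

Lemma proper_rev x y s : proper_chords x y s -> proper_chords y x (rev s).
Proof.
case=> ds hx ly xs yp; split; rewrite ?head_rev ?last_rev ?revK //.
exact: detour_rev.
Qed.

Lemma proper_flipl x y s : proper_chords x y s -> proper_chords x y (flipl x s).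
Proof.
case=> ds hx ly xs yp; split.
- exact: detour_flipl.
- exact: adj_head_flipl.
- exact: last_flipl_adj.
- exact: second_flipl_neq.
by rewrite penult_flipl.
Qed.

Lemma proper_flipr x y s : proper_chords x y s -> proper_chords x y (flipr y s).
Proof. by move=> /proper_rev/proper_flipl/proper_rev. Qed.

Lemma proper_fliplK x y s : proper_chords x y s -> flipl x (flipl x s) = s.
Proof. by case=> ds hx _ _ _; rewrite fliplK ?(nbr_head ds) ?detour_uniq. Qed.

Lemma proper_fliprK x y s : proper_chords x y s -> flipr y (flipr y s) = s.
Proof. by case=> ds _ ly _ _; rewrite fliprK ?(nbr_last ds) ?detour_uniq. Qed.

(** All ends have degree two, so the only nontrivial rotations of a detour in [O] are those about
    [x] and [y]. The list [O] need contain only one orientation of each detour. *)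
Lemma proper_closed x y (O : seq (seq G)) C :
  (forall t, t \in O -> [/\ proper_chords x y t, flipl x t \in O & flipr y t \in O]) ->
  (forall P, reflect (exists2 t, t \in O & P = trace t) (P \in C)) -> flip_closed C.
Proof.
move=> HO CP t z dt /CP[o oO E] hz; apply/CP.
have [po oL oR] := HO o oO; have [do_ hx ly xs yp] := po.
have [tE|tE] := trace_inj (detour_uniq do_) (detour_uniq dt) (esym E).
  rewrite tE in hz *.
  have [->|->] := degree2P (detour_head_degree do_) hx (adj_second do_) xs hz.
    by exists (flipl x o).
  by rewrite flipl_id //; exists o.
rewrite tE head_rev in hz *; rewrite trace_flipl_rev.
have [->|->] := degree2P (detour_last_degree do_) ly (adj_penult do_) yp hz.
  by exists (flipr y o).
by rewrite flipr_id //; exists o.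
Qed.

(** By the braid relation the orbit of [s] under the two involutions consists of the six sequences
    in [O]. *)
Lemma cross_closed s x y : detour s -> adj (hd s) x -> adj (lst s) y ->
  flipl x (flipr y s) <> phi s x y ->
  flip_closed (trace (flipl x (flipr y s)) |: (trace (flipl x (phi s x y)) |: Phi s)).
Proof.
move=> ds hx ly /(cross_card ds hx ly)[xs yp W _].
have p1 : proper_chords x y s by split.
have p2 := proper_flipl p1; have p3 := proper_flipr p1.
have p4 : proper_chords x y (phi s x y) by apply: proper_flipr p2.
have p5 := proper_flipl p3; have p6 := proper_flipl p4.
pose O := [:: s; flipl x s; flipr y s; phi s x y;
  flipl x (flipr y s); flipl x (phi s x y)].
apply: (@proper_closed x y O) => [t|P].
  rewrite /O !inE => /or4P[/eqP->|/eqP->|/eqP->|].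
  - by rewrite !eqxx !orbT.
  - by rewrite (proper_fliplK p1) -/(phi s x y) !eqxx !orbT.
  - by rewrite (proper_fliprK p1) !eqxx !orbT.
  case/or3P=> /eqP->.
  - by rewrite /phi (proper_fliprK p2) !eqxx !orbT.
  - by rewrite (proper_fliplK p3) W !eqxx !orbT.
  - rewrite (proper_fliplK p4) -W in p6 *.
    by rewrite (proper_fliprK p5) !eqxx !orbT.
have hs := adj_second ds; have lp := adj_penult ds.
rewrite in_setU1 in_setU1; apply: (iffP or3P) => [[/eqP->|/eqP->|]|[t]].
- by exists (flipl x (flipr y s)); rewrite // !inE eqxx !orbT.
- by exists (flipl x (phi s x y)); rewrite // !inE eqxx !orbT.
- case/PhiP=> x' [y' [hx' ly' ->]]; exists (phi s x' y') => //.
  case: (degree2P (detour_head_degree ds) hx hs xs hx') => ->;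
    case: (degree2P (detour_last_degree ds) ly lp yp ly') => ->.
  + by rewrite !inE eqxx !orbT.
  + by rewrite -comm_penult // flipr_id // !inE eqxx !orbT.
  + by rewrite phi_second // !inE eqxx !orbT.
  by rewrite phi_second // flipr_id // !inE eqxx.
rewrite !inE => /or4P[/eqP->|/eqP->|/eqP->|] => [->|->|->|].
- constructor 3; apply/PhiP; exists (second s), (penult s).
  by rewrite phi_second // flipr_id.
- constructor 3; apply/PhiP; exists x, (penult s).
  by rewrite -comm_penult // flipr_id.
- by constructor 3; apply/PhiP; exists (second s), y; rewrite phi_second.
case/or3P=> /eqP-> ->; [constructor 3|constructor 1|constructor 2] => //.
by apply/PhiP; exists x, y.
Qed.

Lemma nonham_false : False.
Proof.
case: (set_0Vmem (detours G)) => [D0|[P /detoursP[s ds _]]].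
  by move: Dodd; rewrite D0 cards0.
have h2 := detour_head_degree ds; have l2 := detour_last_degree ds.
have [/existsP[x /existsP[y /and3P[hx ly /eqP ncomm]]]|comm] := boolP [exists x, exists y,
  [&& adj (hd s) x, adj (lst s) y & flipl x (flipr y s) != phi s x y]].
  have [_ _ _ card6] := cross_card ds hx ly ncomm.
  rewrite card_Phi // h2 l2 in card6.
  apply: (no_closed (cross_closed ds hx ly ncomm)); rewrite ?card6 //.
  rewrite !subUset !sub1set Phi_sub // andbT.
  rewrite (detour_trace (detour_phi' ds hx ly)) detour_trace //.
  apply: detour_flipl; first exact: detour_phi.
  rewrite head_flipr; first exact: adj_head_flipl.
  by rewrite (perm_mem (perm_flipl _ _)) (nbr_last ds).
have cs : commuting s.
  move=> x y hx ly; apply/eqP; apply: contraNT comm => ncomm.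
  by apply/existsP; exists x; apply/existsP; exists y; rewrite hx ly.
have cl : flip_closed (Phi s).
  apply: Phi_closed => // [x hx _|y ly _].
    by apply: detour_head_degree; apply: detour_flipl.
  by apply: detour_last_degree; apply: detour_flipr.
by apply: (no_closed cl (Phi_sub ds)); rewrite ?card_Phi // h2 l2.
Qed.

End Detours.
Lemma bigminn_le (I : finType) (P : pred I) (F : I -> nat) m i : P i ->
  \big[minn/m]_(j | P j) F j <= F i.
Proof.
move=> Pi; rewrite -big_filter.
have : i \in [seq j <- index_enum I | P j] by rewrite mem_filter Pi mem_index_enum.
elim: [seq _ <- _ | _] => // j r IH; rewrite inE big_cons => /orP[/eqP<-|/IH].
  exact: geq_minl.
by move=> H; rewrite geq_min H orbT.
Qed.

Lemma le_bigminn (I : finType) (P : pred I) (F : I -> nat) m k : k <= m ->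
  (forall i, P i -> k <= F i) -> k <= \big[minn/m]_(j | P j) F j.
Proof.
by move=> km kF; apply: (big_ind (leq k)) => // a b ka kb; rewrite leq_min ka.
Qed.

(** * Detours with adjacent ends *)

Section Hamiltonian.
Variables (G : sgraph) (x0 : G) (s : seq G).
Hypotheses (ds : detour s) (closing : adj (head x0 s) (last x0 s)).

Lemma rot_detour i : detour (rot i s).
Proof.
have [us ss H] := ds; split; rewrite ?rot_uniq ?size_rot //.
have : cycle (@adj G) (rot i s).
  rewrite rot_cycle; case: (s) (detour_neq0 x0 ds) ss closing => //= a r _ ar.
  by rewrite rcons_path ar adj_sym.
by case: (rot i s) => //= a r; rewrite rcons_path => /andP[].
Qed.

(** Shifting the cycle makes [u] the first vertex of a detour, to which [nbr_head] applies. *)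
Lemma nbr_in_detour u v : adj u v -> u \in s -> v \in s.
Proof.
move=> uv us; rewrite -(mem_rot (index u s)).
apply: (nbr_head (rot_detour _) (x0 := x0)).
by rewrite /rot (drop_nth x0) ?index_mem //= nth_index.
Qed.

Lemma detour_spans : connected G -> size s = #|G|.
Proof.
move=> /forallP conn; have [us _ _] := ds; rewrite -(card_uniqP us); apply: eq_card => z.
have /forallP/(_ z)/connectP[p + ->] := conn (head x0 s).
have : head x0 s \in s by apply/head_mem/(detour_neq0 x0 ds).
by elim: p (head x0 s) => //= v p IH u us' /andP[/nbr_in_detour/(_ us')/IH].
Qed.

Lemma rot_trace_inj : 2 < size s ->
  injective (fun i : 'I_(size s) => trace (rot i s)).
Proof.
move=> s3 i j /trace_inj; rewrite !rot_uniq; have [us _ _] := ds.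
case/(_ x0 us us) => [|] E.
  apply/val_inj/eqP; rewrite /= -(nth_uniq x0 _ _ us) //.
  have hr (k : 'I_(size s)) : nth x0 s k = head x0 (rot k s).
    by rewrite /rot (drop_nth x0).
  by rewrite !hr E.
(* Equality with a reversed shift would identify cyclic successor and predecessor, impossible on
   three or more vertices. *)
have nextprev z : next s z = prev s z.
  by rewrite -(next_rot j us) E next_rev ?rot_uniq // prev_rot.
exfalso; case: (s) us s3 nextprev => [|a [|b [|c r]]] // us _ nextprev.
have := next_prev us a; rewrite -nextprev.
move: us; rewrite /= eqxx !inE !negb_or [b == a]eq_sym.
case/andP=> /and3P[/negbTE-> ac _] _.
by rewrite eqxx => /esym/eqP; rewrite (negbTE ac).
Qed.

Lemma hamiltonian_num_detours : connected G -> 2 < #|G| -> #|G| <= num_detours G.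
Proof.
move=> conn G3; have sG := detour_spans conn; rewrite -{1}sG.
rewrite -[X in X <= _]card_ord -(card_imset _ (rot_trace_inj _)) ?sG //.
apply: subset_leq_card; apply/subsetP=> P /imsetP[i _ ->].
by apply: (detour_trace x0); apply: rot_detour.
Qed.

End Hamiltonian.

Lemma degree_ge_min (G : sgraph) (x : G) : min_degree G <= degree x.
Proof. exact: (@bigminn_le _ xpredT). Qed.

Lemma odd_num_detours (G : sgraph) :
  connected G -> 2 <= min_degree G -> 9 <= #|G| ->
  odd (num_detours G) -> 9 <= num_detours G.
Proof.
move=> conn d2 G9 Dodd; rewrite leqNgt; apply/negP => D9.
have G3 : 2 < #|G| by apply: leq_trans G9.
have /card_gt0P[x0 _] : 0 < #|G| by apply: leq_trans G9.
apply: (@nonham_false G x0) => //.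
- move=> s ds; apply/negP => closing; move: D9; rewrite ltnNge => /negP[].
  by apply: leq_trans G9 (hamiltonian_num_detours ds closing conn G3).
- by move=> x; apply: leq_trans d2 (degree_ge_min x).
(* An odd number below nine is at most seven. *)
rewrite -/(num_detours G) -ltnS ltn_neqAle -ltnS D9 andbT.
by apply: contraTneq Dodd => ->.
Qed.
(** * Extremal graphs *)

Section Template.
Variables (E : seq (nat * nat)) (c m : nat).

Definition code_adj : rel nat :=
  fun u v => (u != v) && (((u, v) \in E) || ((v, u) \in E)).

(* All vertices [i >= c] share the letter [c] and are twins: they are pairwise
   nonadjacent and have the same neighbours. *)
Definition code (i : 'I_m.+1) := minn i c.

Lemma template_sym : symmetric (fun i j => code_adj (code i) (code j)).
Proof. by move=> i j; rewrite /code_adj eq_sym orbC. Qed.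

Lemma template_irrefl : irreflexive (fun i j => code_adj (code i) (code j)).
Proof. by move=> i; rewrite /code_adj eqxx. Qed.

Definition template := SGraph template_sym template_irrefl.

(* The codes of all paths with [k.+1] vertices; the letter [c] may occur several
   times, as it stands for different vertices. *)
Fixpoint words k : seq (seq nat) :=
  if k is k'.+1 then
    [seq v :: w | w <- words k',
      v <- [seq v <- iota 0 c.+1 | code_adj v (head 0 w) && ((v == c) || (v \notin w))]]
  else [seq [:: v] | v <- iota 0 c.+1].

Lemma words0 : words 0 = [seq [:: v] | v <- iota 0 c.+1]. Proof. by []. Qed.

Lemma wordsS k : words k.+1 = [seq v :: w | w <- words k, v <- [seq v <- iota 0 c.+1 |
  code_adj v (head 0 w) && ((v == c) || (v \notin w))]].
Proof. by []. Qed.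

Lemma code_adj_sym : symmetric code_adj.
Proof. by move=> u v; rewrite /code_adj eq_sym orbC. Qed.

Lemma code_lt (x : template) : code x < c -> x = code x :> nat.
Proof. by rewrite /code gtn_min ltnn orbF => /ltnW/minn_idPl. Qed.

Lemma code_letter (x : template) : code x \in iota 0 c.+1.
Proof. by rewrite mem_iota add0n ltnS geq_minr. Qed.

(** A code below [c] determines its vertex, so a path can repeat no letter other than [c]. *)
Lemma path_word (s : seq template) k : size s = k.+1 -> uniq s ->
  sorted (@adj template) s -> map code s \in words k.
Proof.
elim: k s => [|k IH] [|x s] //.
  by case: s => // _ _ _; rewrite words0; apply/mapP;
    exists (code x); rewrite ?code_letter.
move=> [sk] /andP[xs us] ss; rewrite wordsS; apply/allpairsPdep.
exists (map code s), (code x); split=> //.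
  by apply: IH => //; case: (s) ss => //= y r /andP[].
rewrite mem_filter code_letter andbT; case: s sk xs us ss => //= y r _ xs us /andP[xy _].
rewrite [code_adj _ _]xy /=; have [//|xc] := eqVneq (code x) c.
have xc' : code x < c by rewrite ltn_neqAle xc geq_minr.
rewrite -[_ :: map code r]/(map code (y :: r)); apply/mapP => -[z zs xz].
have := code_lt xc'; rewrite xz -code_lt -?xz // => /val_inj xE.
by rewrite xE zs in xs.
Qed.

Lemma wordP k (w : seq nat) : w \in words k -> [/\ size w = k.+1, sorted code_adj w,
  {in w, forall u, u <= c} & c \notin w -> uniq w].
Proof.
elim: k w => [|k IH] w; rewrite ?words0 ?wordsS.
  case/mapP=> v; rewrite mem_iota ltnS => /= vc ->; split=> // u.
  by rewrite inE => /eqP->.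
case/allpairsPdep=> w' [v [/IH[sw sorted_w w_le uw]]].
rewrite mem_filter mem_iota ltnS => /andP[/andP[vw vN] /= vc] ->; split=> /=.
- by rewrite sw.
- by case: (w') sw vw sorted_w => //= u r _ -> .
- by move=> u; rewrite inE => /predU1P[->//|]; apply: w_le.
rewrite inE negb_or => /andP[cv /uw ->]; rewrite andbT.
by case/orP: vN => // /eqP vE; rewrite vE eqxx in cv.
Qed.

Hypothesis cm : c <= m.+1.

(** Intended for letters below [c], each the code of exactly one vertex because [c <= m.+1]; at
    equality there are no twins. *)
Definition lift_word (w : seq nat) : seq template := map inord w.

Lemma code_inord u : u < c -> code (inord u) = u.
Proof.
by move=> uc; rewrite /code inordK ?(leq_trans uc cm) //; apply/minn_idPl/ltnW.
Qed.

Lemma inord_code (x : template) : code x < c -> inord (code x) = x.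
Proof. by move=> xc; rewrite -code_lt // inord_val. Qed.

Lemma lt_letters (w : seq nat) :
  {in w, forall u, u <= c} -> c \notin w -> {in w, forall u, u < c}.
Proof.
move=> wc cw u uw; rewrite ltn_neqAle wc // andbT.
by apply: contraNneq cw => <-.
Qed.

Lemma map_code_lift_word (w : seq nat) :
  {in w, forall u, u < c} -> map code (lift_word w) = w.
Proof.
move=> wc; rewrite -map_comp -[RHS]map_id; apply/eq_in_map => u /wc uc.
exact: code_inord.
Qed.

Lemma lift_word_code (s : seq template) : {in map code s, forall u, u < c} ->
  lift_word (map code s) = s.
Proof.
move=> sc; rewrite /lift_word -map_comp -[RHS]map_id; apply/eq_in_map => x xs.
by apply: inord_code; apply/sc/map_f.
Qed.

(** [K] is the number of edges of a detour, and [W] lists one orientation of each. Words avoiding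
    [c] come from exactly one path. *)
Definition detour_check K W :=
  [&& nilp (words K.+1), all (fun w => w \in W ++ map rev W) (words K),
      all (fun w => [&& w \in words K, c \notin w & rev w \notin W]) W,
      0 < size W & uniq W].

Lemma num_detours_template K W : detour_check K W -> num_detours template = size W.
Proof.
case/and5P=> /nilP noK1 /allP allK /allP Wok W0 uW.
have Wlift w : w \in W -> [/\ size (lift_word w) = K.+1, uniq (lift_word w),
    sorted (@adj template) (lift_word w) & map code (lift_word w) = w].
  move=> /Wok/and3P[/wordP[sw ssw wc uw] cw _]; have wlt := lt_letters wc cw.
  have E1 := map_code_lift_word wlt.
  split=> //; first by rewrite size_map.
    by apply: (@map_uniq _ _ code); rewrite E1 uw.
  by rewrite -E1 sorted_map in ssw.
have sizeK (s : seq template) : uniq s -> sorted (@adj template) s -> size s <= K.+1.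
  move=> us ss; rewrite leqNgt; apply/negP => Ks.
  (* [words K.+1] describes paths with exactly [K.+2] vertices, so a longer path is truncated. *)
  have : map code (take K.+2 s) \in words K.+1.
    by apply: path_word; rewrite ?size_takel ?take_uniq ?take_sorted.
  by rewrite noK1.
have x0 : template := ord0.
have dW w : w \in W -> detour (lift_word w).
  by move=> /Wlift[sw uw ssw _]; split=> // t ut st; rewrite sw sizeK.
pose L := map (fun w => trace (lift_word w)) W.
have -> : num_detours template = #|L|.
  apply: eq_card => P; apply/(detoursP x0)/mapP => [[s ds ->]|[w wW ->]]; last first.
    by exists (lift_word w); first exact: dW.
  have sK : size s = K.+1.
    have [us ss smax] := ds; apply/eqP; rewrite eqn_leq sizeK //=.
    case: (W) W0 Wlift => // w W' _ /(_ w (mem_head _ _))[<- uw ssw _].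
    exact: smax.
  have [us ss _] := ds; have := allK _ (path_word sK us ss).
  rewrite mem_cat => /orP[sW|/mapP[w wW sE]].
    exists (map code s) => //; have [_ _ _ E1] := Wlift _ sW.
    rewrite lift_word_code // -E1 => u.
    have /and3P[/wordP[_ _ wc _] cw _] := Wok _ sW; rewrite E1; exact: lt_letters.
  exists w => //; have /and3P[/wordP[_ _ wc _] cw _] := Wok _ wW.
  rewrite -(trace_rev s) -(@lift_word_code (rev s)) map_rev sE revK //.
  exact: lt_letters.
have uL : uniq L.
  rewrite map_inj_in_uniq // => w w' wW wW' E1.
  have [_ uw _ cw] := Wlift _ wW; have [_ uw' _ cw'] := Wlift _ wW'.
  case: (trace_inj x0 uw uw' E1) => /(congr1 (map code));
    rewrite ?map_rev cw cw' // => wE.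
  by have /and3P[_ _] := Wok _ wW; rewrite -wE wW'.
by rewrite (card_uniqP uL) size_map.
Qed.

(** Any list containing the codes that occur. In the examples of order nine it must omit [c], a
    letter that there has neither vertices nor neighbours and would fail the checks. *)
Variable L : seq nat.
Hypothesis codeL : forall x : template, code x \in L.

(** Counting only neighbours with letters below [c], one vertex each, bounds the degree from
    below. *)
Lemma min_degree_template : 1 < c ->
  all (fun u => 1 < count (code_adj u) (iota 0 c)) L -> 1 < min_degree template.
Proof.
move=> c1 /allP Lok; apply: le_bigminn => [|x _].
  by rewrite card_ord (leq_trans c1).
have := Lok _ (codeL x); rewrite -size_filter => d2; apply: leq_trans d2 _.
apply/card_geqP; exists (lift_word [seq u <- iota 0 c | code_adj (code x) u]).
split; last 1 first.
- move=> y /mapP[u]; rewrite mem_filter mem_iota => /and3P[xu _ uc] ->.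
  by rewrite inE /= code_inord.
- apply: (@map_uniq _ _ code); rewrite map_code_lift_word ?filter_uniq ?iota_uniq //.
  by move=> u; rewrite mem_filter mem_iota => /and3P[].
by rewrite size_map.
Qed.

(* Letters reached from the root [0] (or [1] if [v = 0]) avoiding [v]. *)
Definition reach k v := iter k (fun R =>
  R ++ [seq u <- iota 0 c | [&& u \notin R, u != v & has (code_adj u) R]])
  [:: (v == 0) : nat].

(** [v] is the letter of a deleted vertex; [c.+1], the code of no vertex, means that none below [c]
    is deleted. The letter [c] never enters [reach]: each twin has to be adjacent to a reached
    letter. *)
Definition conn_check v :=
  let R := reach c v in all (fun u => [|| u == v, u \in R | has (code_adj u) R]) L.

Lemma conn_checkP (S : {set template}) v : 1 < c -> conn_check v ->
  (forall u, u < c -> u != v -> inord u \notin S) ->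
  (forall x, x \notin S -> code x != v) -> connected (del_vertices S).
Proof.
move=> c1 /allP check alive vS.
have r_c : (v == 0 : nat) < c by case: (v == 0); rewrite // (ltn_trans _ c1).
have r_v : (v == 0 : nat) != v by case: v {check alive vS r_c} => [|[|v]].
pose H := del_vertices S.
pose mk (x : template) (h : x \notin S) : H := exist _ x h.
have mk_irr x y (h : x \notin S) (h' : y \notin S) : x = y -> mk x h = mk y h'.
  by move=> xy; apply: val_inj.
pose r := mk _ (alive _ r_c r_v).
have reachP k u : u \in reach k v -> [/\ u < c, u != v &
    forall h : inord u \notin S, connect (@adj H) r (mk _ h)].
  elim: k u => [|k IH] u.
    rewrite /reach inE => /eqP->; split=> // h.
    by rewrite (mk_irr _ _ h (alive _ r_c r_v)).
  rewrite /reach iterS -/(reach k v) mem_cat => /orP[/IH//|]; rewrite mem_filter mem_iota.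
  case/and3P=> /and3P[_ uv /hasP[w /IH[wc wv rw] uw]] _ uc; split=> // h.
  apply: connect_trans (rw (alive _ wc wv)) (connect1 _).
  by rewrite /= /del_adj /= !code_inord // code_adj_sym.
have conn_r (x : H) : connect (@adj H) r x.
  have xE : code (val x) \in reach c v -> connect (@adj H) r x.
    move=> /reachP[xc xv rx]; have xS := alive _ xc xv.
    rewrite (_ : x = mk _ xS) //.
    by apply: val_inj; rewrite /= inord_code.
  have := check _ (codeL (val x)); rewrite (negbTE (vS _ (valP x))) /=.
  case/orP=> [//|/hasP[u /reachP[uc uv ru] xu]].
  apply: connect_trans (ru (alive _ uc uv)) (connect1 _).
  by rewrite /= /del_adj /= code_inord // code_adj_sym.
apply/forallP => x; apply/forallP => y.
apply: connect_trans (conn_r y); rewrite (sym_connect_sym (@adj_sym H)); exact: conn_r.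
Qed.

(* Deleting [S] separates [a], in [T], from [b], outside [T]. *)
Definition cut_check (S T : seq nat) a b :=
  [&& all (fun u => u < c) S,
      all (fun u => all (fun v =>
        [|| u \in S, v \in S, u \notin T, v \in T | ~~ code_adj u v]) L) L,
      [&& a < c, a \notin S & a \in T] & [&& b < c, b \notin S & b \notin T]].

Lemma cut_checkP S T a b : cut_check S T a b -> connectivity template <= size S.
Proof.
case/and4P=> /allP Sc /allP cut /and3P[ac aS aT] /and3P[bc bS bT].
pose X : {set template} := [set x | code x \in S].
apply: (@leq_trans #|X|); last first.
  have XS : X \subset lift_word S.
    apply/subsetP=> x; rewrite inE => xS; apply/mapP.
    by exists (code x) => //; rewrite inord_code // Sc.
  by rewrite (leq_trans (subset_leq_card XS)) // (leq_trans (card_size _)) // size_map.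
apply: bigminn_le; apply/orP; left; apply/negP => conn.
have aX : (inord a : template) \notin X by rewrite inE code_inord.
have bX : (inord b : template) \notin X by rewrite inE code_inord.
pose H := del_vertices X.
(* After deleting [X], the vertices with letters in [T] form a union of components. *)
have Hcl : fingraph.closed (@adj H) [pred x : H | code (val x) \in T].
  apply: intro_closed; first exact: sym_connect_sym (@adj_sym H).
  move=> x y xy; rewrite !inE => xT; apply: contraTT xy => yT.
  have /allP := cut _ (codeL (val x)); move/(_ _ (codeL (val y))).
  have := valP x; have := valP y; rewrite !inE => /negbTE-> /negbTE->.
  by rewrite xT (negbTE yT).
have /forallP/(_ (Sub (inord a) aX))/forallP/(_ (Sub (inord b) bX)) := conn.
by move=> /(closed_connect Hcl); rewrite !inE /= !code_inord // aT (negbTE bT).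
Qed.

(** As [k <= 2], the lower bound concerns deletions of at most one vertex. Deleting a twin is
    covered by the check at [c.+1], like deleting nothing. *)
Lemma connectivity_template k S T a b : 2 < c -> k <= 2 ->
  all conn_check (c.+1 :: if k == 2 then iota 0 c else [::]) ->
  cut_check S T a b -> size S = k -> connectivity template = k.
Proof.
move=> c2 k2 /= /andP[conn0 /allP conn1] cut Sk; apply/eqP.
rewrite eqn_leq -{1}Sk (cut_checkP cut) /=.
have c3 : 2 < #|template| by rewrite card_ord (leq_trans c2).
apply: le_bigminn => [|X]; first by rewrite (leq_trans k2) // ltnW.
apply: contraTT; rewrite -ltnNge => Xk; rewrite negb_or negbK.
have X1 : #|X| <= 1 by rewrite -ltnS (leq_trans Xk).
apply/andP; split; last first.
  have XC : #|del_vertices X| = #|~: X|.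
    by rewrite card_sig; apply: eq_card => x; rewrite !inE.
  rewrite XC; apply/negP => /eqP X'; have := cardsC X; rewrite X' => cE.
  by move: c3; rewrite -cE addn1 ltnS ltnNge X1.
have [X0|] := eqVneq #|X| 0.
  apply: (@conn_checkP X c.+1) => // [|u uc _|x _]; first exact: ltnW.
    by rewrite (cards0_eq X0) inE.
  by rewrite neq_ltn ltnS geq_minr.
rewrite -lt0n => X0; have /cards1P[x Xx] : #|X| == 1 by rewrite eqn_leq X1.
have kE : k == 2 by rewrite eqn_leq k2 (leq_ltn_trans _ Xk).
rewrite kE in conn1.
have [xc|xc] := ltnP x c.
  apply: (@conn_checkP X x) => // [|||].
  - exact: ltnW.
  - by apply: conn1; rewrite mem_iota.
  - move=> u uc ux; rewrite Xx inE; apply: contraNneq ux => <-.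
    by rewrite inordK // (leq_trans uc).
  move=> y; rewrite Xx inE; apply: contraNneq => yx; apply/eqP/val_inj.
  by rewrite /= -yx; apply: code_lt; rewrite yx.
apply: (@conn_checkP X c.+1) => // [|u uc _|y _]; first exact: ltnW.
  rewrite Xx inE; apply: contraTneq xc => <-.
  by rewrite inordK -?ltnNge // (leq_trans uc).
by rewrite neq_ltn ltnS geq_minr.
Qed.

Lemma template_spec K W k S T a b :
  1 < c -> 2 < c -> k <= 2 ->
  all (fun u => 1 < count (code_adj u) (iota 0 c)) L ->
  all conn_check (c.+1 :: if k == 2 then iota 0 c else [::]) ->
  cut_check S T a b -> size S = k -> detour_check K W ->
  [/\ #|template| = m.+1, 1 < min_degree template, connectivity template = k
    & num_detours template = size W].
Proof.
move=> c1 c2 k2 deg conn cut Sk det; split.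
- by rewrite card_ord.
- exact: min_degree_template.
- exact: connectivity_template cut Sk.
exact: num_detours_template det.
Qed.

End Template.

(* Deleting [0] and [1] leaves the components [{2,3,4,5}], [{6,7}], [{8,9}] and the
   twins [10, 11, ...] as singletons. A path meets at most three components, so a
   longest one avoids the twins and covers the other three; hence the number of
   detours does not depend on the number of twins. *)
Definition theta_edges : seq (nat * nat) :=
  [:: (2, 3); (3, 4); (4, 5); (2, 4); (0, 2); (0, 5); (6, 7); (0, 6); (1, 7);
      (1, 6); (8, 9); (0, 8); (1, 9); (0, 10); (1, 10)].

(** Three spanning paths of [{2,3,4,5}] ending next to [0], times three ways to continue through [1]
    and the two other components. *)
Definition theta_detours : seq (seq nat) :=
  [seq w ++ 0 :: w' | w <- [:: [:: 2; 3; 4; 5]; [:: 3; 2; 4; 5]; [:: 5; 4; 3; 2]],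
    w' <- [:: [:: 6; 7; 1; 9; 8]; [:: 8; 9; 1; 7; 6]; [:: 8; 9; 1; 6; 7]]].

(** Two five-cycles, each with a chord, sharing the vertex [4]. Each has three spanning paths that
    end at [4]. *)
Definition bowtie_edges : seq (nat * nat) :=
  [:: (0, 1); (1, 2); (2, 3); (3, 4); (0, 2); (0, 4);
      (4, 5); (5, 6); (6, 7); (7, 8); (8, 6); (8, 4)].

Definition bowtie_detours : seq (seq nat) :=
  [seq w ++ 4 :: w' | w <- [:: [:: 0; 1; 2; 3]; [:: 1; 0; 2; 3]; [:: 3; 2; 1; 0]],
    w' <- [:: [:: 5; 6; 7; 8]; [:: 5; 6; 8; 7]; [:: 8; 7; 6; 5]]].

(** A nine-cycle has nine detours, one for each omitted edge. *)
Definition cycle_edges : seq (nat * nat) := [seq (i, i.+1 %% 9) | i <- iota 0 9].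

Lemma code9 (x : 'I_9) : code 9 x \in iota 0 9.
Proof. by rewrite /code (minn_idPl (ltnW (ltn_ord x))) mem_iota ltn_ord. Qed.

(** The theta family has ten fixed vertices, so order nine needs its own examples. *)
Lemma order9_examples :
  (exists H : sgraph, [/\ #|H| = 9, 2 <= min_degree H, connectivity H = 1
     & num_detours H = 9]) /\
  (exists M : sgraph, [/\ #|M| = 9, 2 <= min_degree M, connectivity M = 2
     & num_detours M = 9]).
Proof.
split.
  exists (template bowtie_edges 9 8).
  by apply: (@template_spec _ 9 8 _ _ code9 8 bowtie_detours
    1 [:: 4] [:: 0; 1; 2; 3] 0 5); vm_compute.
exists (template cycle_edges 9 8).
by apply: (@template_spec _ 9 8 _ _ code9 8 [seq rot i (iota 0 9) | i <- iota 0 9]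
  2 [:: 0; 3] [:: 1; 2] 1 4); vm_compute.
Qed.

Lemma large_order_examples m : 9 <= m ->
  (exists H : sgraph, [/\ #|H| = m.+1, 2 <= min_degree H, connectivity H = 1
     & num_detours H = 9]) /\
  (exists M : sgraph, [/\ #|M| = m.+1, 2 <= min_degree M, connectivity M = 2
     & num_detours M = 9]).
Proof.
move=> m9; split.
  exists (template theta_edges 10 m).
  (* The checks involve letters only, so they compute with [m] a variable. *)
  by apply: (@template_spec _ 10 m m9 _ (@code_letter _ 10 m) 9 theta_detours
    1 [:: 0] [:: 2; 3; 4; 5] 2 6); vm_compute.
(* The edge from [1] to [4] raises the connectivity to two. No spanning path of [{2,3,4,5}] starts
   at [4], because [5] is a leaf there, so no detour uses the new edge. *)
exists (template ((1, 4) :: theta_edges) 10 m).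
by apply: (@template_spec _ 10 m m9 _ (@code_letter _ 10 m) 9 theta_detours
  2 [:: 0; 1] [:: 2; 3; 4; 5] 2 6); vm_compute.
Qed.

Theorem theorem2 :
  (forall G : sgraph,
     connected G -> 2 <= min_degree G -> 9 <= #|G| ->
     odd (num_detours G) -> 9 <= num_detours G)
  /\
  (forall n : nat, 9 <= n ->
     (exists H : sgraph,
        [/\ #|H| = n, 2 <= min_degree H, connectivity H = 1
          & num_detours H = 9])
     /\
     (exists M : sgraph,
        [/\ #|M| = n, 2 <= min_degree M, connectivity M = 2
          & num_detours M = 9])).
Proof.
split; first exact: odd_num_detours.
case=> // m; rewrite leq_eqVlt => /predU1P[<-|]; first exact: order9_examples.
exact: large_order_examples.
Qed.
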